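(* Let $\Gamma$ be a smoothly embedded circle of length $L(\Gamma)$ in a complete Riemannian manifold. The following assertions are equivalent: i) $\mathcal{S}(\Gamma)=L(\Gamma)/2$. ii) For every $x,y\in\Gamma$, the distance between $x$ and $y$ (in the ambient Riemannian manifold) equals the length of the shortest arc of $\Gamma$ bounded by these two points.
   Context: Let $d$ be the Riemannian distance of the ambient manifold. A family $\{p_t,q_t\}\subset\Gamma$, $t\in[0,1]$, is a sweepout of $\Gamma$ if (i) $p_0=q_0$, $p_1=q_1$; (ii) $t\mapsto p_t$, $t\mapsto q_t$ are continuous; (iii) $p_t,q_t$ bound a closed arc $C_t\subset\Gamma$ with $t\mapsto C_t$ continuous (distance between arcs = length of symmetric difference), $C_0=\{p_0\}$, $C_1=\Gamma$. The width is $\mathcal{S}(\Gamma)=\inf\max_{t\in[0,1]}d(p_t,q_t)$ over all sweepouts of $\Gamma$. *)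

(* Defs.v *)
From HB Require Import structures.
From mathcomp Require Import all_boot all_order all_algebra.
From mathcomp Require Import all_classical all_reals all_analysis.

Set Implicit Arguments.
Unset Strict Implicit.
Unset Printing Implicit Defensive.

Import Order.TTheory GRing.Theory Num.Theory.
Import numFieldNormedType.Exports.

Local Open Scope classical_set_scope.
Local Open Scope ring_scope.

Section Smooth.
Context {R : realType} {V W : normedModType R}.

(* Meant for U open and V finite-dimensional: f is of class C^(k+1) iff it is
   differentiable and x |-> 'd f x v is of class C^k for every v. *)
Fixpoint Ck_on (k : nat) (U : set V) (f : V -> W) : Prop :=
  if k is k'.+1 then
    (forall x, U x -> differentiable f x) /\ (forall v, Ck_on k' U ('D_v f))
  else forall x, U x -> {for x, continuous f}.

Definition smooth_on (U : set V) (f : V -> W) := forall k, Ck_on k U f.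

End Smooth.

(* A smooth n-manifold without boundary is given by an atlas, and its metric by
   the Gram matrices gram i of the metric in the coordinates of the charts i.
   Tangent vectors in coordinates are row vectors, so that the inner product of
   v and w at the point of coordinates u is v *m gram i u *m w^T. The map
   param i is the inverse of chart i; chart_at selects a chart around each
   point. *)
Record riemannianManifold (R : realType) (n : nat) := RiemannianManifold {
  carrier :> topologicalType ;
  carrier_hausdorff : hausdorff_space carrier ;
  carrier_second_countable : @second_countable carrier ;

  atlas : Type ;
  chart_dom : atlas -> set carrier ;
  chart : atlas -> carrier -> 'rV[R]_n ;
  param : atlas -> 'rV[R]_n -> carrier ;
  chart_dom_open : forall i, open (chart_dom i) ;
  chart_codom_open : forall i, open (chart i @` chart_dom i) ;
  chartK : forall i x, chart_dom i x -> param i (chart i x) = x ;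
  chart_continuous : forall i x, chart_dom i x -> {for x, continuous (chart i)} ;
  param_continuous : forall i u, (chart i @` chart_dom i) u ->
    {for u, continuous (param i)} ;
  chart_at : carrier -> atlas ;
  chart_dom_at : forall x, chart_dom (chart_at x) x ;
  transition_smooth : forall i j,
    smooth_on (chart i @` (chart_dom i `&` chart_dom j)) (chart j \o param i) ;

  gram : atlas -> 'rV[R]_n -> 'M[R]_n ;
  gram_smooth : forall i, smooth_on (chart i @` chart_dom i) (gram i) ;
  gram_sym : forall i x, chart_dom i x ->
    (gram i (chart i x))^T = gram i (chart i x) ;
  gram_posdef : forall i x (v : 'rV[R]_n), chart_dom i x -> v != 0 ->
    0 < (v *m gram i (chart i x) *m v^T) 0 0 ;
  gram_transition : forall i j x (v w : 'rV[R]_n),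
    chart_dom i x -> chart_dom j x ->
    let T := chart j \o param i in
    v *m gram i (chart i x) *m w^T =
    'D_v T (chart i x) *m gram j (chart j x) *m ('D_w T (chart i x))^T
}.

Section Riemannian.
Context {R : realType} {n : nat} {M : riemannianManifold R n}.
Implicit Types (c : R -> M) (x y : M).

Definition smooth_curve (U : set R) c :=
  (forall t, U t -> {for t, continuous c}) /\
  forall i : atlas M, smooth_on (U `&` c @^-1` chart_dom i) (chart i \o c).

Definition velocity c (t : R) : 'rV[R]_n := 'D_1 (chart (chart_at (c t)) \o c) t.

Definition speed c (t : R) : R :=
  let v := velocity c t in
  let i := chart_at (c t) in
  Num.sqrt ((v *m gram i (chart i (c t)) *m v^T) 0 0).

Record piece := Piece { curve : R -> M ; tmin : R ; tmax : R }.

(* Smoothness up to the end points means that there is a smooth extension to a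
   neighbourhood of the closed interval. *)
Definition smooth_piece (s : piece) :=
  tmin s <= tmax s /\
  exists U : set R,
    [/\ open U, `[tmin s, tmax s] `<=` U & smooth_curve U (curve s)].

Definition piece_length (s : piece) : \bar R :=
  (\int[lebesgue_measure]_(t in `[tmin s, tmax s]) (speed (curve s) t)%:E)%E.

(* A piecewise smooth curve from x to y is the list of its smooth pieces, each
   one starting where the previous one ends. *)
Fixpoint piecewise_smooth_path x y (p : seq piece) : Prop :=
  if p is s :: p' then
    [/\ smooth_piece s, curve s (tmin s) = x
      & piecewise_smooth_path (curve s (tmax s)) y p']
  else x = y.

Definition path_length (p : seq piece) : \bar R :=
  (\sum_(s <- p) piece_length s)%E.

(* M is not assumed to be connected: riem_dist x y = +oo when x and y lie in
   different components. *)
Definition riem_dist x y : \bar R :=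
  ereal_inf [set path_length p | p in piecewise_smooth_path x y].

Definition riem_cauchy (u : nat -> M) :=
  forall e : R, 0 < e -> exists N, forall k l,
    (N <= k)%N -> (N <= l)%N -> (riem_dist (u k) (u l) < e%:E)%E.

Definition riem_cvg (u : nat -> M) x :=
  forall e : R, 0 < e -> exists N, forall k,
    (N <= k)%N -> (riem_dist (u k) x < e%:E)%E.

End Riemannian.

Definition riem_complete (R : realType) (n : nat) (M : riemannianManifold R n) :=
  forall u : nat -> M, riem_cauchy u -> exists x, riem_cvg u x.

(* A smooth embedding of the circle R/Z, presented as a 1-periodic map on R.
   The last field says that the induced bijection from R/Z to the image is
   open, the open sets of R/Z being the 1-periodic open sets of R. *)
Record embeddedCircle (R : realType) (n : nat) (M : riemannianManifold R n) :=
  EmbeddedCircle {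
    circle_map :> R -> M ;
    circle_periodic : forall t, circle_map (t + 1) = circle_map t ;
    circle_smooth : smooth_curve setT circle_map ;
    circle_immersion : forall t, velocity circle_map t != 0 ;
    circle_inj : forall s t, 0 <= s < 1 -> 0 <= t < 1 ->
      circle_map s = circle_map t -> s = t ;
    circle_open : forall U : set R, open U -> (forall t, U (t + 1) <-> U t) ->
      exists2 O : set M, open O & circle_map @` U = O `&` range circle_map
  }.

Section Circle.
Context {R : realType} {n : nat} {M : riemannianManifold R n}.
Variable G : embeddedCircle M.

(* The length of a (measurable) subset A of the circle. *)
Definition length_in (A : set M) : \bar R :=
  (\int[lebesgue_measure]_(t in `[0%R, 1%R[ `&` G @^-1` A) (speed G t)%:E)%E.

Definition circle_length : \bar R := length_in (range G).

(* C is a closed arc of G bounded by x and y, in either order; if x = y then C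
   is either the point x or the whole circle. *)
Definition closed_arc (x y : M) (C : set M) :=
  exists a b : R, [/\ a <= b <= a + 1, C = G @` `[a, b]
    & (x = G a /\ y = G b) \/ (x = G b /\ y = G a)].

Definition shortest_arc (x y : M) (C : set M) :=
  closed_arc x y C /\
  forall C', closed_arc x y C' -> (length_in C <= length_in C')%E.

Definition sweepout (p q : R -> M) (C : R -> set M) :=
  [/\ p 0 = q 0 /\ p 1 = q 1,
      {within `[0, 1], continuous p} /\ {within `[0, 1], continuous q},
      forall t : R, t \in `[0, 1] -> closed_arc (p t) (q t) (C t),
      forall t : R, t \in `[0, 1] ->
        length_in (C s `+` C t) @[s --> within `[0, 1] (nbhs t)] --> 0%E
    & C 0 = [set p 0] /\ C 1 = range G].

(* The supremum over t is a maximum: t |-> riem_dist (p t) (q t) is continuous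
   on the compact interval [0, 1]. *)
Definition width : \bar R :=
  ereal_inf [set w | exists p q C, sweepout p q C /\
    w = ereal_sup [set riem_dist (p t) (q t) | t in `[0, 1]]].

End Circle.

(* Main.v *)
Require Import Defs.
From HB Require Import structures.
From mathcomp Require Import all_boot all_order all_algebra.
From mathcomp Require Import all_classical all_reals all_analysis.
From mathcomp Require Import measurable_realfun.
From mathcomp Require Import zify lra.

Set Implicit Arguments.
Unset Strict Implicit.
Unset Printing Implicit Defensive.

Import Order.TTheory GRing.Theory Num.Theory.
Import numFieldNormedType.Exports.

Local Open Scope classical_set_scope.
Local Open Scope ring_scope.

(* Write d for the ambient distance, L for the length of the circle and l(a, b)
   for the length of its arc G([a, b]), and note that d(G a, G b) <= l(a, b).

   In a sweepout the length of C_t varies continuously from 0 to L, so that some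
   C_t has length L/2. Its complementary arc has length L/2 as well, and (ii)
   gives d(p_t, q_t) = L/2; hence the width is at least L/2. It is at most L/2
   in all cases: keep one point fixed and let the other go round once.

   Conversely, if l(a, b) <= l(b, a + 1) and d(G a, G b) < l(a, b), then the
   sweepout that keeps G a fixed has width < L/2. Indeed, d(G a, G c) is at most
   min(l(a, c), d(G a, G b) + l(c, b)) for c in [a, b], and at most
   min(d(G a, G b) + l(b, c), l(c, a + 1)) for c in [b, a + 1]; as a minimum is
   at most an average, both are <= (d(G a, G b) + l(b, a + 1)) / 2 < L/2. *)

(** * Derivatives under reflection and translation *)

Lemma derive_opp_comp (R : realType) (V W : normedModType R) (f : V -> W) v x :
  'D_v (f \o -%R) x = 'D_(- v) f (- x).
Proof.
rewrite /derive /=; apply: (congr1 (fun g => lim (g @ 0^'))).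
by apply/funext => h /=; rewrite opprD scalerN.
Qed.

Lemma derive_shift_comp (R : realType) (V W : normedModType R) (f : V -> W)
    v a x :
  'D_v (f \o +%R^~ a) x = 'D_v f (x + a).
Proof.
rewrite /derive /=; apply: (congr1 (fun g => lim (g @ 0^'))).
by apply/funext => h /=; rewrite addrA.
Qed.

(** Reflection turns the derivative along [v] into the one along [- v]; the induction goes through
    because [Ck_on] quantifies over all directions. *)
Lemma Ck_on_opp (R : realType) (V W : normedModType R) k (U : set V)
    (f : V -> W) :
  Ck_on k U f -> Ck_on k (-%R @^-1` U) (f \o -%R).
Proof.
elim: k f => [|k IH] f /=.
  move=> cf x Ux; apply: continuous_comp; first exact: oppr_continuous.
  exact: cf.
move=> [df Df]; split.
  by move=> x Ux; apply: differentiable_comp => //; exact: df.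
move=> v; have -> : 'D_v (f \o -%R) = 'D_(- v) f \o -%R.
  by apply/funext => x; exact: derive_opp_comp.
exact: IH.
Qed.

(** * Speed of smooth curves, in any chart *)

Section Speed.
Context {R : realType} {n : nat} {M : riemannianManifold R n}.
Implicit Types (c : R -> M) (U : set R).

Definition gram_norm (i : atlas M) (x : M) (v : 'rV[R]_n) : R :=
  Num.sqrt ((v *m gram i (chart i x) *m v^T) 0 0).

Lemma smooth_curve_chart U c (i : atlas M) t :
    smooth_curve U c -> U t -> chart_dom i (c t) ->
  differentiable (chart i \o c) t /\ {for t, continuous ('D_1 (chart i \o c))}.
Proof.
move=> [cc sc] Ut it.
have [dc Dc] := sc i 1%N; split; first exact: dc.
exact: Dc.
Qed.

Lemma smooth_curve_near_chart U c (i : atlas M) t :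
    smooth_curve U c -> U t -> chart_dom i (c t) ->
  \forall s \near t, chart_dom i (c s).
Proof.
move=> [cc _] Ut it; apply: (cc t Ut).
exact: open_nbhs_nbhs (conj (chart_dom_open i) it).
Qed.

(* The charts chosen by chart_at need not depend continuously on the point; this
   lemma lets the speed be computed in a chart fixed near t. *)
Lemma gram_norm_chart U c (i j : atlas M) t :
    smooth_curve U c -> U t -> chart_dom i (c t) -> chart_dom j (c t) ->
  gram_norm i (c t) ('D_1 (chart i \o c) t) =
  gram_norm j (c t) ('D_1 (chart j \o c) t).
Proof.
move=> sc Ut it jt; rewrite /gram_norm (gram_transition _ _ it jt) /=.
set T := chart j \o param i; set g := chart i \o c.
suff -> : 'D_1 (chart j \o c) t = 'D_('D_1 g t) T (chart i (c t)) by [].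
have [dg _] := smooth_curve_chart sc Ut it.
have dT : differentiable T (g t).
  by have [+ _] := transition_smooth i j 1%N; apply; exists (c t).
(* [chart j \o c] and [T \o g] need agree only while the curve stays in the domain of chart [i],
   hence near [t]. *)
rewrite (@near_eq_derive _ _ _ _ (T \o g)); last first.
  near=> s; rewrite /T /g /= chartK//; near: s.
  exact: smooth_curve_near_chart sc Ut it.
rewrite !deriveE//; last exact: differentiable_comp.
exact: (congr1 (fun h : R -> 'rV[R]_n => h 1) (diff_comp dg dT)).
Unshelve. all: by end_near. Qed.

Lemma speed_chart U c (i : atlas M) t :
    smooth_curve U c -> U t -> chart_dom i (c t) ->
  speed c t = gram_norm i (c t) ('D_1 (chart i \o c) t).
Proof.
by move=> sc Ut it; rewrite -(gram_norm_chart sc Ut (chart_dom_at _) it).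
Qed.

Lemma speed_ge0 c t : 0 <= speed c t.
Proof. exact: sqrtr_ge0. Qed.

(** In a chart fixed near [t] the speed is the square root of a polynomial in continuous functions.
    Continuity serves measurability, integrability and substitution in the length integrals. *)
Lemma speed_continuous U c t :
  open U -> smooth_curve U c -> U t -> {for t, continuous (speed c)}.
Proof.
move=> oU sc Ut; pose i := chart_at (c t).
have it : chart_dom i (c t) by exact: chart_dom_at.
have [dg Dg] := smooth_curve_chart sc Ut it.
have cg := differentiable_continuous dg.
have cgram : {for chart i (c t), continuous (gram i)}.
  by apply: (gram_smooth i 0%N); exists (c t).
pose g := chart i \o c.
have cG : {for t, continuous (gram i \o g)} by exact: continuous_comp.
have eqs : \forall s \near t, speed c s =
    Num.sqrt (('D_1 g s *m gram i (g s) *m ('D_1 g s)^T) 0 0).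
  near=> s; apply: (@speed_chart U) => //; near: s.
    exact: open_nbhs_nbhs.
  exact: smooth_curve_near_chart sc Ut it.
rewrite /prop_for /continuous_at (nbhs_singleton eqs).
apply: (@cvg_trans _ (Num.sqrt (('D_1 g s *m gram i (g s) *m ('D_1 g s)^T) 0 0)
    @[s --> t])).
  by apply: near_eq_cvg; near do apply/esym.
apply: (@continuous_comp _ _ _
    (fun s => ('D_1 g s *m gram i (g s) *m ('D_1 g s)^T) 0 0) (@Num.sqrt R) t);
  last exact: sqrt_continuous.
have ccoord (p q : nat) (h : R -> 'M[R]_(p, q)) a b :
    {for t, continuous h} -> h s a b @[s --> t] --> h t a b.
  move=> ch; apply: (@continuous_comp _ _ _ h (fun A : 'M[R]_(p, q) => A a b) t ch).
  exact: coord_continuous.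
have -> : (fun s => ('D_1 g s *m gram i (g s) *m ('D_1 g s)^T) 0 0) =
    (fun s => \sum_k (\sum_l 'D_1 g s 0 l * gram i (g s) l k) * 'D_1 g s 0 k).
  apply/funext => s; rewrite mxE; apply: eq_bigr => k _; rewrite !mxE.
  by congr (_ * _).
rewrite /prop_for /continuous_at.
apply: (cvg_big add_continuous) => k _; apply: cvgM; last exact: (ccoord _ _ _ _ _ Dg).
apply: (cvg_big add_continuous) => l _; apply: cvgM; first exact: (ccoord _ _ _ _ _ Dg).
exact: (ccoord _ _ _ _ _ cG).
Unshelve. all: by end_near. Qed.

Lemma smooth_curve_opp U c :
  smooth_curve U c -> smooth_curve (-%R @^-1` U) (c \o -%R).
Proof.
move=> [cc sc]; split => [t Ut|i k].
  by apply: continuous_comp; [exact: oppr_continuous|exact: cc].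
exact: Ck_on_opp (sc i k).
Qed.

(** The velocity changes sign, which the quadratic form of the metric does not see. *)
Lemma speed_opp U c t : smooth_curve U c -> U (- t) ->
  speed (c \o -%R) t = speed c (- t).
Proof.
move=> sc Ut; pose i := chart_at (c (- t)).
have [dg _] := smooth_curve_chart sc Ut (chart_dom_at _ : chart_dom i _).
have DN : 'D_1 (chart i \o (c \o -%R)) t = - 'D_1 (chart i \o c) (- t).
  rewrite -[LHS]/('D_1 ((chart i \o c) \o -%R) t) derive_opp_comp /=.
  by rewrite !deriveE// linearN.
rewrite /speed /velocity -[(c \o -%R) t]/(c (- t)) -/i DN.
by rewrite !mulNmx linearN/= mulmxN opprK.
Qed.

End Speed.

(** * Symmetry and triangle inequality of the Riemannian distance *)

Section Distance.
Context {R : realType} {n : nat} {M : riemannianManifold R n}.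
Implicit Types (s : @piece R n M) (p : seq (@piece R n M)) (x y z : M).

Lemma piece_length_ge0 s : (0 <= piece_length s)%E.
Proof. by apply: integral_ge0 => t _; rewrite lee_fin speed_ge0. Qed.

Lemma path_length_ge0 p : (0 <= path_length p)%E.
Proof. by apply: sume_ge0 => s _; exact: piece_length_ge0. Qed.

Lemma path_length_cat p q :
  path_length (p ++ q) = (path_length p + path_length q)%E.
Proof. by rewrite /path_length big_cat. Qed.

Lemma piecewise_smooth_path_cat x y z p q :
  piecewise_smooth_path x y p -> piecewise_smooth_path y z q ->
  piecewise_smooth_path x z (p ++ q).
Proof.
by elim: p x => [x -> //|s p IH] x /= [ss sx /IH pq] /pq.
Qed.

Definition reverse_piece s : @piece R n M :=
  Piece (curve s \o -%R) (- tmax s) (- tmin s).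

Lemma smooth_reverse_piece s : smooth_piece s -> smooth_piece (reverse_piece s).
Proof.
move=> [st [U [oU sU cU]]]; split => /=; first by rewrite lerN2.
exists (-%R @^-1` U); split.
- by apply: open_comp => // t _; exact: oppr_continuous.
- by move=> t /=; rewrite in_itv/= => /andP[? ?]; apply: sU; rewrite /= in_itv/=; lra.
- exact: smooth_curve_opp.
Qed.

(** Substitution by negation; the continuity it requires comes from the neighbourhood on which the
    reversed curve is smooth. *)
Lemma reverse_piece_length s : smooth_piece s ->
  piece_length (reverse_piece s) = piece_length s.
Proof.
move=> /[dup] /smooth_reverse_piece[_ [V [oV sV cV]]] [st [U [oU sU cU]]].
rewrite /piece_length.
have := @integration_by_substitution_oppr R (speed (curve s \o -%R)) _ _ st.
move=> /= ->; last first.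
  apply: continuous_in_subspaceT => t /set_mem tV.
  by apply: (@speed_continuous _ _ _ V) => //; exact: sV.
apply: eq_integral => t /set_mem ts; rewrite /= (@speed_opp _ _ _ U) ?opprK//.
exact: sU.
Qed.

Lemma piecewise_smooth_path_rev x y p : piecewise_smooth_path x y p ->
  exists2 q, piecewise_smooth_path y x q & path_length q = path_length p.
Proof.
elim: p x => [x -> |s p IH x /= [ss sx /IH[q yq qp]]]; first by exists [::].
exists (q ++ [:: reverse_piece s]).
  apply: piecewise_smooth_path_cat yq _ => /=; rewrite !opprK.
  by split => //; exact: smooth_reverse_piece.
rewrite path_length_cat qp /path_length big_seq1 big_cons.
by rewrite reverse_piece_length// addeC.
Qed.

Lemma riem_dist_ge0 x y : (0 <= riem_dist x y)%E.
Proof. by apply: le_ereal_inf_tmp => _ [p _ <-]; exact: path_length_ge0. Qed.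

Lemma riem_dist_le x y p :
  piecewise_smooth_path x y p -> (riem_dist x y <= path_length p)%E.
Proof. by move=> xyp; apply: ereal_inf_lbound; exists p. Qed.

Lemma riem_dist_sym x y : riem_dist x y = riem_dist y x.
Proof.
wlog suff: x y / (riem_dist x y <= riem_dist y x)%E.
  by move=> h; apply/eqP; rewrite eq_le !h.
apply: le_ereal_inf_tmp => _ [p /piecewise_smooth_path_rev[q xyq <-] <-].
exact: riem_dist_le.
Qed.

(** Concatenate two paths whose lengths are within [e / 2] of the distances. Infinite distances are
    set apart, as near-minimal paths are extracted from a finite infimum. *)
Lemma riem_dist_triangle x y z :
  (riem_dist x z <= riem_dist x y + riem_dist y z)%E.
Proof.
have [-> |xyoo] := eqVneq (riem_dist x y) +oo%E.
  by rewrite addye ?leey// gt_eqF// (lt_le_trans _ (riem_dist_ge0 _ _)).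
have [-> |yzoo] := eqVneq (riem_dist y z) +oo%E.
  by rewrite addey ?leey// gt_eqF// (lt_le_trans _ (riem_dist_ge0 _ _)).
have xyf : riem_dist x y \is a fin_num.
  by rewrite ge0_fin_numE ?riem_dist_ge0// lt_neqAle xyoo leey.
have yzf : riem_dist y z \is a fin_num.
  by rewrite ge0_fin_numE ?riem_dist_ge0// lt_neqAle yzoo leey.
apply/lee_addgt0Pr => e e0; have e20 : 0 < e / 2 by lra.
have [_ [p xyp <-] pe] := lb_ereal_inf_adherent e20 xyf.
have [_ [q yzq <-] qe] := lb_ereal_inf_adherent e20 yzf.
apply: (le_trans (riem_dist_le (piecewise_smooth_path_cat xyp yzq))).
rewrite path_length_cat [e]splitr EFinD addeACA.
by apply: leeD; exact: ltW.
Qed.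

Lemma riem_dist_curve U (c : R -> M) a b : open U -> smooth_curve U c ->
  a <= b -> `[a, b] `<=` U ->
  (riem_dist (c a) (c b) <=
   \int[lebesgue_measure]_(t in `[a, b]) (speed c t)%:E)%E.
Proof.
move=> oU cU ab abU; apply: (le_trans (@riem_dist_le _ _ [:: Piece c a b] _)).
  by split => //; split => //; exists U.
by rewrite /path_length big_seq1.
Qed.

End Distance.

(** * Arc length in the periodic parameter, and lengths of arcs *)

Section Arclength.
Context {R : realType} {n : nat} {M : riemannianManifold R n}.
Variable G : embeddedCircle M.
Notation mu := (@lebesgue_measure R).

Lemma circle_continuous : continuous G.
Proof. by move=> t; have [+ _] := circle_smooth G; exact. Qed.

Lemma speed_circle_continuous : continuous (speed G).
Proof.
by move=> t; apply: (speed_continuous openT (circle_smooth G)).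
Qed.

Lemma circleDz t (k : int) : G (t + k%:~R) = G t.
Proof.
elim: k => [|k IH|k IH]; first by rewrite addr0.
  by rewrite -addn1 PoszD intrD addrA circle_periodic.
rewrite -(circle_periodic G (t + _)) -IH; congr (G _).
by rewrite -addrA; congr (_ + _); rewrite -addn1 PoszD opprD rmorphB/= subrK.
Qed.

Lemma speed_circleDz t (k : int) : speed G (t + k%:~R) = speed G t.
Proof.
rewrite /speed /velocity circleDz; set i := chart_at _.
suff -> : 'D_1 (chart i \o G) (t + k%:~R) = 'D_1 (chart i \o G) t by [].
rewrite -derive_shift_comp; congr ('D_1 _ t).
by apply/funext => s /=; rewrite circleDz.
Qed.

(** [circle_inj] speaks only of [0, 1), so both parameters are replaced by their fractional
    parts. *)
Lemma circle_eq s t : G s = G t -> exists k : int, s = t + k%:~R.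
Proof.
move=> e.
have fl (u : R) : 0 <= u - (Num.floor u)%:~R < 1.
  by rewrite subr_ge0 ge_floor ltrBlDl -intrD1 floorD1_gt.
have /eqP : s - (Num.floor s)%:~R = t - (Num.floor t)%:~R.
  by apply: (circle_inj (e := G)) => //; rewrite -!rmorphN/= !circleDz.
rewrite subr_eq => /eqP ->; exists (Num.floor s - Num.floor t).
by rewrite rmorphB/=; lra.
Qed.

(** Measured along the lift to the line and real-valued, so that linear arithmetic applies. It
    counts repeated turns, and it is 0 when [b < a]. *)
Definition arclength a b : R := \int[mu]_(t in `[a, b]) speed G t.

Lemma measurable_speed_circle (D : set R) : measurable D ->
  measurable_fun D (fun t => (speed G t)%:E).
Proof.
move=> mD; apply/measurable_EFinP; apply: (measurable_funS measurableT) => //.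
by apply: continuous_measurable_fun; exact: speed_circle_continuous.
Qed.

Lemma integrable_speed_circle a b : mu.-integrable `[a, b] (EFin \o speed G).
Proof.
apply: continuous_compact_integrable; first exact: segment_compact.
by apply: continuous_subspaceT; exact: speed_circle_continuous.
Qed.

Lemma arclengthE a b :
  (\int[mu]_(t in `[a, b]) (speed G t)%:E)%E = (arclength a b)%:E.
Proof.
rewrite /arclength /Rintegral fineK//.
exact: (integrable_fin_num _ (integrable_speed_circle a b)).
Qed.

Lemma arclength_ge0 a b : 0 <= arclength a b.
Proof. by apply: Rintegral_ge0 => t _; exact: speed_ge0. Qed.

Lemma arclengthxx a : arclength a a = 0.
Proof. by rewrite /arclength set_itv1 Rintegral_set1. Qed.

Lemma arclengthD b a c : a <= b -> b <= c ->
  arclength a c = arclength a b + arclength b c.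
Proof.
move=> ab bc; apply/eqP; rewrite addrC -subr_eq; apply/eqP.
rewrite /arclength Rintegral_itvB ?bnd_simp//; last exact: integrable_speed_circle.
rewrite Rintegral_itv_obnd_cbnd//.
apply: integrableS (integrable_speed_circle b c) => //.
exact: subset_itv_oc_cc.
Qed.

Lemma arclengthDz a b (k : int) : a <= b ->
  arclength (a + k%:~R) (b + k%:~R) = arclength a b.
Proof.
move=> ab; apply: EFin_inj; rewrite -!arclengthE.
have dF (x : R) : is_derive x 1 (fun t => t + k%:~R) 1.
  by apply: is_derive_eq; rewrite addr0.
have D1 : derive1 (fun t : R => t + k%:~R) = cst 1.
  by apply/funext => x; rewrite derive1E derive_val.
have := @integration_by_substitution_increasing R (fun t => t + k%:~R)
  (speed G) a b ab.
move=> /= ->.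
- apply: eq_integral => t _; rewrite /= !fctE D1 /cst mulr1 speed_circleDz//.
- by move=> s t _ _ st; rewrite ltrD2r.
- by move=> t _; rewrite D1; exact: cvg_cst.
- by rewrite D1; exact: is_cvg_cst.
- by rewrite D1; exact: is_cvg_cst.
- have cF : continuous (fun t : R => t + k%:~R).
    by move=> t; apply: cvgD; [exact: cvg_id|exact: cvg_cst].
  split => //.
  + by apply: cvg_at_right_filter; exact: cF.
  + by apply: cvg_at_left_filter; exact: cF.
- by apply: continuous_subspaceT; exact: speed_circle_continuous.
Qed.

Notation L := (arclength 0 1).

(** With [k] the integer part of [a], cutting [a, a + 1] at [k + 1] and [k, k + 1] at [a] leaves a
    common piece and two pieces that are translates by 1. *)
Lemma arclength_period a : arclength a (a + 1) = L.
Proof.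
pose k := Num.floor a.
have ka : k%:~R <= a by exact: ge_floor.
have ak : a <= 1 + k%:~R by rewrite addrC -intrD1 ltW// floorD1_gt.
have := arclengthDz k ler01; rewrite add0r => <-.
rewrite (arclengthD ak); last lra.
rewrite (arclengthD ka ak) addrC; congr (_ + _).
by have := arclengthDz 1 ka; rewrite mulr1z [_ + 1]addrC => ->.
Qed.

Lemma image_circleDz a b (k : int) :
  G @` `[a + k%:~R, b + k%:~R] = G @` `[a, b].
Proof.
apply/seteqP; split=> [_ [t + <-]|_ [t + <-]]; rewrite /= !in_itv/= => /andP[? ?].
  exists (t - k%:~R); first by rewrite /= in_itv/=; lra.
  by rewrite -rmorphN circleDz.
exists (t + k%:~R); first by rewrite /= in_itv/=; lra.
exact: circleDz.
Qed.

Lemma image_circle_period a : G @` `[a, a + 1] = range G.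
Proof.
apply/seteqP; split=> [_ [t _ <-]|_ [t _ <-]]; first by exists t.
pose k := Num.floor (t - a).
have : k%:~R <= t - a by exact: ge_floor.
have : t - a < k%:~R + 1 by rewrite -intrD1 floorD1_gt.
exists (t - k%:~R); first by rewrite /= in_itv/=; lra.
by rewrite -rmorphN circleDz.
Qed.

Lemma circle_lengthE : circle_length G = L%:E.
Proof.
rewrite /circle_length /length_in -arclengthE.
have -> : `[0%R, 1%R[%classic `&` G @^-1` range G = `[0%R, 1%R[%classic :> set R.
  by apply/seteqP; split=> [t []//|t ?]; split => //; exists t.
by rewrite integral_itv_bndo_bndc//; exact: measurable_speed_circle.
Qed.

(** Links the two ways of measuring an arc: [length_in] integrates over the preimage in [0, 1),
    which is one interval, or two when the arc runs past an integer parameter. *)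
Lemma length_in_arc a b : a <= b <= a + 1 ->
  length_in G (G @` `[a, b]) = (arclength a b)%:E.
Proof.
(* A parameter interval of length 1 covers the whole circle and is set apart; otherwise an integer
   translation brings [a] into [0, 1). *)
move=> /andP[ab]; rewrite le_eqVlt => /predU1P[->|ba1].
  by rewrite image_circle_period -/(circle_length G) circle_lengthE arclength_period.
wlog a01 : a b ab ba1 / 0 <= a < 1.
  move=> h; have := h (a - (Num.floor a)%:~R) (b - (Num.floor a)%:~R).
  rewrite -rmorphN image_circleDz arclengthDz//; apply => //.
  - by rewrite lerD2r.
  - lra.
  - by rewrite rmorphN subr_ge0 ge_floor ltrBlDl -intrD1 floorD1_gt.
have inj01 s t : 0 <= s < 1 -> 0 <= t < 1 -> G s = G t -> s = t.
  exact: (circle_inj (e := G)).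
rewrite /length_in; have [b1|b1] := ltP b 1.
  rewrite -arclengthE; congr (integral _ _ _).
  apply/seteqP; split=> [t [/= + [s /=]]|t /=]; rewrite !in_itv/=.
    by move=> t01 sab /inj01 <-//; lra.
  by move=> tab; split; [lra|exists t => //=; rewrite in_itv].
(* Here [b >= 1]: the part of the arc beyond 1 reappears as [0, b - 1]. *)
have -> : `[0%R, 1%R[%classic `&` G @^-1` (G @` `[a, b]) =
    `[0%R, b - 1]%classic `|` `[a, 1%R[%classic :> set R.
  apply/seteqP; split=> [t [/= + [s /=]]|t [|]/=]; rewrite !in_itv/=.
  - move=> t01 sab; have [s1|s1] := ltP s 1 => Gst.
      have st : s = t by apply: inj01 Gst => //; lra.
      by right; lra.
    have st : s - 1 = t.
      by apply: inj01 => //; [lra|rewrite -Gst -[in RHS](subrK 1 s) circle_periodic].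
    by left; lra.
  - move=> tb; split; first lra.
    by exists (t + 1); rewrite /= ?in_itv/= ?circle_periodic//; lra.
  - by move=> at1; split; [lra|exists t; rewrite //= in_itv/=; lra].
rewrite ge0_integral_setU//.
- rewrite integral_itv_bndo_bndc; last exact: measurable_speed_circle.
  rewrite !arclengthE -EFinD addrC; congr (_%:E).
  rewrite (@arclengthD 1 a b)//; last lra.
  congr (_ + _); have /(_ _ _ 1) := arclengthDz.
  by move=> <-; rewrite ?add0r ?subrK//; lra.
- by apply: measurable_speed_circle; exact: measurableU.
- by move=> t _; rewrite lee_fin speed_ge0.
- apply/disj_setPS => t [] /=; rewrite !in_itv/=; lra.
Qed.

(** Arcs are compact, hence closed in a Hausdorff space. *)
Lemma measurable_arc a b : measurable (G @^-1` (G @` `[a, b])).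
Proof.
apply: closed_measurable; apply: closed_comp.
  by move=> t _; exact: circle_continuous.
apply: compact_closed; first exact: carrier_hausdorff.
apply: continuous_compact; last exact: segment_compact.
by apply: continuous_subspaceT; exact: circle_continuous.
Qed.

Lemma le_length_in (A B : set M) :
  measurable (G @^-1` A) -> measurable (G @^-1` B) -> A `<=` B ->
  (length_in G A <= length_in G B)%E.
Proof.
move=> mA mB AB; apply: ge0_subset_integral.
- exact: measurableI.
- exact: measurableI.
- by apply: measurable_speed_circle; exact: measurableI.
- by move=> t _; rewrite lee_fin speed_ge0.
- by move=> t [t01 At]; split => //; exact: AB.
Qed.

Lemma length_inU (A B : set M) :
  measurable (G @^-1` A) -> measurable (G @^-1` B) ->
  (length_in G (A `|` B) <= length_in G A + length_in G B)%E.
Proof.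
move=> mA mB; rewrite {1}/length_in.
have -> : `[0%R, 1%R[%classic `&` G @^-1` (A `|` B) =
    (`[0%R, 1%R[%classic `&` G @^-1` A) `|`
    (`[0%R, 1%R[%classic `&` G @^-1` (B `\` A)) :> set R.
  apply/seteqP; split=> [t [t01 [At|Bt]]|t [[t01 At]|[t01 [Bt _]]]].
  - by left.
  - by have [At|At] := pselect (A (G t)); [left|right].
  - by split=> //; left.
  - by split=> //; right.
have mBA : measurable (G @^-1` (B `\` A)) by exact: measurableD.
rewrite ge0_integral_setU//.
- by rewrite leeD2l//; apply: le_length_in => // x [].
- exact: measurableI.
- exact: measurableI.
- by apply: measurable_speed_circle; apply: measurableU; exact: measurableI.
- by move=> t _; rewrite lee_fin speed_ge0.
- by apply/disj_setPS => t [] /= [_ ?] [_ []].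
Qed.

End Arclength.

(** * Comparison of arcs, rotation sweepouts and upper bounds for the width *)

Section Width.
Context {R : realType} {n : nat} {M : riemannianManifold R n}.
Variable G : embeddedCircle M.
Notation arclength := (arclength G).
Notation L := (arclength 0 1).

Lemma riem_dist_le_arclength a b : a <= b ->
  (riem_dist (G a) (G b) <= (arclength a b)%:E)%E.
Proof.
by move=> ab; rewrite -arclengthE; exact: riem_dist_curve openT (circle_smooth G) _ _.
Qed.

Lemma closed_arc_sym x y C : closed_arc G x y C -> closed_arc G y x C.
Proof.
by move=> [a [b [ab -> xy]]]; exists a, b; split => //; case: xy => -[-> ->]; [right|left].
Qed.

(** The equation with [fine] expresses that the length is finite. *)
Lemma closed_arc_length x y C : closed_arc G x y C ->
  length_in G C = (fine (length_in G C))%:E /\ measurable (G @^-1` C).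
Proof.
move=> [a [b [ab -> _]]]; rewrite length_in_arc//; split => //.
exact: measurable_arc.
Qed.

(* When x = y an arc is a point or the whole circle, so that the alternative
   covers the degenerate arcs too. *)
Lemma closed_arc_length_eq x y C C' :
  closed_arc G x y C -> closed_arc G x y C' ->
  length_in G C' = length_in G C \/
  (length_in G C' + length_in G C = L%:E)%E.
Proof.
move=> [a [b [ab -> xyab]]] [a' [b' [ab' -> xyab']]].
(* Lifts of the same end points differ by integers. As both parameter intervals have length at most
   1, the relative shift is in {-1, 0, 1} when the ends correspond in order, and in {0, 1, 2} when
   they are exchanged. *)
have int_bound (k : int) : - 2%:R < k%:~R :> R -> k%:~R < 3%:R :> R ->
    [\/ k = -1, k = 0, k = 1 | k = 2].
  rewrite -[- 2%:R]/((- 2)%:~R) -[3%:R]/(3%:~R) !ltr_int => k2 k3.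
  have : [|| k == -1, k == 0, k == 1 | k == 2] by lia.
  by move=> /or4P[] /eqP; [constructor 1|constructor 2|constructor 3|constructor 4].
(* A nonzero shift is possible only between a point and the whole circle. *)
have same : G a' = G a -> G b' = G b -> arclength a' b' = arclength a b \/
    arclength a' b' + arclength a b = L.
  move=> /circle_eq[j a'E] /circle_eq[k b'E].
  have -> : arclength a' b' = arclength a (b + (k - j)%:~R).
    rewrite -(@arclengthDz _ _ _ G a _ j) intrB; last lra.
    by rewrite a'E b'E -addrA subrK.
  have := int_bound (k - j); rewrite intrB => -[||kj|kj|kj|kj]; try lra.
  - have := congr1 (fun z : int => z%:~R : R) kj; rewrite intrB mulrN1z/= => kjr.
    have -> : b = a + 1 by lra.
    by right; rewrite kjr addrK arclengthxx add0r arclength_period.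
  - have := congr1 (fun z : int => z%:~R : R) kj; rewrite intrB/= => ->.
    by left; rewrite addr0.
  - have := congr1 (fun z : int => z%:~R : R) kj; rewrite intrB/= => kjr.
    have -> : b = a by lra.
    by right; rewrite kjr arclength_period arclengthxx addr0.
  - by have := congr1 (fun z : int => z%:~R : R) kj; rewrite intrB/=; lra.
(* Shift 1 gives the complementary arc; shift 0 forces both arcs to be a point, and shift 2 both to
   be the whole circle. *)
have opposite : G a' = G b -> G b' = G a -> arclength a' b' = arclength a b \/
    arclength a' b' + arclength a b = L.
  move=> /circle_eq[j a'E] /circle_eq[k b'E].
  have -> : arclength a' b' = arclength b (a + (k - j)%:~R).
    rewrite -(@arclengthDz _ _ _ G b _ j) intrB; last lra.
    by rewrite a'E b'E -addrA subrK.
  have := int_bound (k - j); rewrite intrB/= => -[||kj|kj|kj|kj]; try lra.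
  - by have := congr1 (fun z : int => z%:~R : R) kj; rewrite intrB/=; lra.
  - have := congr1 (fun z : int => z%:~R : R) kj; rewrite intrB/= => kjr.
    by left; rewrite kjr addr0; have -> : b = a by lra.
  - have := congr1 (fun z : int => z%:~R : R) kj; rewrite intrB/= => kjr.
    right; rewrite kjr addrC -arclengthD ?arclength_period//; lra.
  - have := congr1 (fun z : int => z%:~R : R) kj; rewrite intrB/= => kjr.
    have -> : b = a + 1 by lra.
    left; rewrite kjr; have -> : a + 2 = a + 1 + 1 by lra.
    by rewrite !arclength_period.
rewrite !length_in_arc// -EFinD.
suff : arclength a' b' = arclength a b \/ arclength a' b' + arclength a b = L.
  by move=> [->|->]; [left|right].
by case: xyab xyab' => -[-> ->] [] [xE yE]; [apply: same|apply: opposite|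
  apply: opposite|apply: same].
Qed.

Lemma arclength_rotation_continuous (a t : R) : 0 <= t <= 1 ->
  arclength a (a + s) @[s --> within `[0, 1] (nbhs t)] --> arclength a (a + t).
Proof.
move=> t01; have aa1 : a <= a + 1 by lra.
have := parameterized_integral_continuous aa1 (integrable_speed_circle G a (a + 1)).
move=> /subspace_continuousP/(_ (a + t)).
rewrite /= in_itv/= => /(_ ltac:(lra)) ca.
apply: (@cvg_trans _ (arclength a u @[u --> within `[a, a + 1] (nbhs (a + t))])).
  have cat : a + s @[s --> t] --> a + t by apply: cvgD; [exact: cvg_cst|exact: cvg_id].
  move=> P wP; have := cat _ wP.
  apply: (@filterS _ (nbhs t)) => s Ps s01; apply: Ps; move: s01.
  by rewrite /= !in_itv/=; lra.
exact: ca.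
Qed.

(** The arcs are nested, and what the larger adds lies in G([a + s, a + t]). An upper bound is
    enough to squeeze the length to 0. *)
Lemma length_in_symdiff (a s t : R) : 0 <= s -> s <= t -> t <= 1 ->
  (length_in G ((G @` `[a, (a + s)%R]) `+` (G @` `[a, (a + t)%R])) <=
   (arclength a (a + t) - arclength a (a + s))%:E)%E.
Proof.
move=> s0 st t1; rewrite (@arclengthD _ _ _ G (a + s) a); [|lra|lra].
rewrite addrAC subrr add0r -length_in_arc; last lra.
have mA u : measurable (G @^-1` (G @` `[a, a + u])) by exact: measurable_arc.
have mD u v : measurable (G @^-1` ((G @` `[a, a + u]) `\` (G @` `[a, a + v]))).
  exact: measurableD (mA u) (mA v).
apply: le_length_in; [|exact: measurable_arc|].
  exact: measurableU (mD s t) (mD t s).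
move=> _ [[[u /= + <-]] []|[[u /= + <-]] /=]; rewrite in_itv/= => uat.
  by exists u; rewrite //= in_itv/=; lra.
move=> ns; exists u => //; rewrite /= in_itv/=; apply/andP; split; last lra.
rewrite leNgt; apply/negP => us; apply: ns; exists u; rewrite //= in_itv/=; lra.
Qed.

(** One end stays at [G a] while the other goes round once; all upper bounds for the width come from
    this sweepout. *)
Lemma sweepout_rotation a :
  sweepout G (fun=> G a) (fun t => G (a + t)) (fun t => G @` `[a, a + t]).
Proof.
split.
- by rewrite addr0 circle_periodic.
- split; apply: continuous_subspaceT; first exact: cst_continuous.
  move=> t; apply: continuous_comp; last exact: circle_continuous.
  by apply: cvgD; [exact: cvg_cst|exact: cvg_id].
- move=> t; rewrite in_itv/= => t01; exists a, (a + t); split => //; first lra.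
  by left.
- move=> t; rewrite in_itv/= => t01.
  apply: (@squeeze_cvge _ _ _ _ (cst 0%E) _
    (fun s => `|arclength a (a + t) - arclength a (a + s)|%:E)).
  + near=> s.
    have : 0 <= s <= 1 by near: s; apply: withinT.
    move=> s01; apply/andP; split.
      by apply: integral_ge0 => u _; rewrite lee_fin speed_ge0.
    have [st|ts] := leP s t.
      apply: (le_trans (length_in_symdiff _ _ st _)); [lra|lra|].
      by rewrite lee_fin ler_norm.
    rewrite setYC; apply: (le_trans (length_in_symdiff _ _ (ltW ts) _)); [lra|lra|].
    by rewrite lee_fin distrC ler_norm.
  + exact: cvg_cst.
  + apply: cvg_EFin; first by near=> s.
    rewrite -[X in _ --> X](normr0 R) -[X in `|X|](subrr (arclength a (a + t))).
    apply: cvg_norm; apply: cvgB; first exact: cvg_cst.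
    exact: arclength_rotation_continuous.
- by rewrite addr0 set_itv1 image_set1 image_circle_period.
Unshelve. all: by end_near. Qed.

Lemma width_le_rotation (a K : R) :
  (forall t : R, 0 <= t <= 1 -> (riem_dist (G a) (G (a + t)%R) <= K%:E)%E) ->
  (width G <= K%:E)%E.
Proof.
move=> dK; apply: (@le_trans _ _
  (ereal_sup [set riem_dist (G a) (G (a + t)) | t in `[0, 1]])).
  apply: ereal_inf_lbound.
  by exists (fun=> G a), (fun t => G (a + t)), (fun t => G @` `[a, a + t]); split => //;
    exact: sweepout_rotation.
apply: ge_ereal_sup => _ [t /= + <-]; rewrite in_itv/=; exact: dK.
Qed.

Lemma width_le : (width G <= (2^-1 * L)%:E)%E.
Proof.
apply: (@width_le_rotation 0) => t t01; rewrite add0r.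
have Lt : L = arclength 0 t + arclength t 1 by apply: arclengthD; lra.
have d1 := @riem_dist_le_arclength 0 t.
have d2 := @riem_dist_le_arclength t 1; rewrite riem_dist_sym in d2.
(* [G 0] is also [G 1], so the arcs on both sides of [G t] bound the same distance, and one of them
   is at most half of [L]. *)
rewrite -(circle_periodic G 0) add0r in d1 *.
have [h|h] := leP (arclength 0 t) (2^-1 * L).
  by apply: (le_trans (d1 _)); [lra|rewrite lee_fin].
by apply: (le_trans (d2 _)); [lra|rewrite lee_fin; lra].
Qed.

Lemma riem_dist_width (a b : R) : a <= b <= a + 1 ->
  arclength a b <= arclength b (a + 1) ->
  width G = (2^-1 * L)%:E ->
  riem_dist (G a) (G b) = (arclength a b)%:E.
Proof.
move=> /andP[ab ba1] short wG; apply/eqP; rewrite eq_le riem_dist_le_arclength//=.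
rewrite leNgt; apply/negP => dlt.
have d_fin : riem_dist (G a) (G b) \is a fin_num.
  by rewrite ge0_fin_numE ?riem_dist_ge0// (lt_trans dlt)// ltry.
set d := fine (riem_dist (G a) (G b)).
have dE : riem_dist (G a) (G b) = d%:E by rewrite fineK.
move: dlt; rewrite dE lte_fin => dlt.
have LE : L = arclength a b + arclength b (a + 1).
  by rewrite -(arclength_period G a); exact: arclengthD.
(* For [c] beyond [b] this is the average of the two competing bounds on the distance; for [c]
   before [b] it is at least their average, by [short]. *)
have : (width G <= ((d + arclength b (a + 1)) / 2)%:E)%E.
  apply: (@width_le_rotation a) => t t01; set c := a + t.
  have dac : (riem_dist (G a) (G c) <= (arclength a c)%:E)%E.
    by apply: riem_dist_le_arclength; rewrite /c; lra.
  have dbc : (riem_dist (G a) (G c) <= d%:E + riem_dist (G b) (G c))%E.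
    by rewrite -dE; exact: riem_dist_triangle.
  have [cb|bc] := leP c b.
    have := @arclengthD _ _ _ G c a b; rewrite {1}/c => /(_ ltac:(lra) cb) abE.
    have [h|h] := leP (arclength a c) ((d + arclength b (a + 1)) / 2).
      by apply: (le_trans dac); rewrite lee_fin.
    apply: (le_trans dbc); rewrite riem_dist_sym.
    apply: (le_trans (leeD2l _ (riem_dist_le_arclength cb))).
    by rewrite -EFinD lee_fin; lra.
  have ca1 : c <= a + 1 by rewrite /c; lra.
  have ba1E := @arclengthD _ _ _ G c b (a + 1) (ltW bc) ca1.
  have [h|h] := leP (arclength c (a + 1)) ((d + arclength b (a + 1)) / 2).
    rewrite -(circle_periodic G a) riem_dist_sym.
    by apply: (le_trans (riem_dist_le_arclength ca1)); rewrite lee_fin.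
  apply: (le_trans dbc).
  apply: (le_trans (leeD2l _ (riem_dist_le_arclength (ltW bc)))).
  by rewrite -EFinD lee_fin; lra.
(* Since [d < arclength a b], the bound is below half of [L]. *)
by rewrite wG lee_fin; lra.
Qed.

End Width.

(** * From the width to shortest arcs and back *)

Section Equivalence.
Context {R : realType} {n : nat} {M : riemannianManifold R n}.
Variable G : embeddedCircle M.
Notation arclength := (arclength G).
Notation L := (arclength 0 1).

(** By [closed_arc_length_eq] a competing arc has the same length or the complementary one,
    [arclength b (a + 1)], which is not smaller by hypothesis. *)
Lemma shortest_arc_width (a b : R) : a <= b <= a + 1 ->
  arclength a b <= arclength b (a + 1) -> width G = (2^-1 * L)%:E ->
  exists C, shortest_arc G (G a) (G b) C /\
    riem_dist (G a) (G b) = length_in G C.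
Proof.
move=> ab short wG; exists (G @` `[a, b]).
have arc : closed_arc G (G a) (G b) (G @` `[a, b]).
  by exists a, b; split => //; left.
have abE := length_in_arc G ab.
split; last by rewrite abE (riem_dist_width ab short wG).
split => // C' arc'; have [->//|] := closed_arc_length_eq arc arc'.
have [-> _] := closed_arc_length arc'.
rewrite abE -EFinD => -[sumL]; rewrite lee_fin.
have := @arclengthD _ _ _ G b a (a + 1); rewrite arclength_period => LE.
by have := LE ltac:(lra) ltac:(lra); lra.
Qed.

(** Intermediate value theorem: the length of [C t] is continuous because the lengths of two sets
    differ by at most that of their symmetric difference. *)
Lemma sweepout_half (p q : R -> M) (C : R -> set M) : sweepout G p q C ->
  exists2 t : R, 0 <= t <= 1 & length_in G (C t) = (2^-1 * L)%:E.
Proof.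
move=> [[pq0 pq1] _ arcC cC [C0 C1]].
pose g t := fine (length_in G (C t)).
have gE (t : R) : 0 <= t <= 1 -> length_in G (C t) = (g t)%:E.
  by move=> t01; have [] := closed_arc_length (arcC t t01).
have mC (t : R) : 0 <= t <= 1 -> measurable (G @^-1` C t).
  by move=> t01; have [] := closed_arc_length (arcC t t01).
have cg : {within `[0, 1], continuous g}.
  apply/subspace_continuousP => t /= t01; have {}t01 : 0 <= t <= 1 by [].
  (* Convergence to 0 in the extended reals also gives finiteness near [t], so that [fine] loses
     nothing there. *)
  have /fine_cvgP[fin Ct0] := cC t t01.
  have {}Ct0 : fine (length_in G (C s `+` C t)) @[s --> within `[0, 1] (nbhs t)] --> (0 : R).
    exact: Ct0.
  apply/cvgrPdist_le => e e0.
  have near0 := (@cvgrPdist_le _ _ _ _ _ _ _).1 Ct0 e e0.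
  near=> s; have s01 : 0 <= s <= 1.
    suff : `[0, 1]%classic s by rewrite /= in_itv.
    by near: s; exact: withinT.
  have fins : length_in G (C s `+` C t) \is a fin_num by near: s; exact: fin.
  have : `|0 - fine (length_in G (C s `+` C t))| <= e.
    by near: s; exact: near0.
  rewrite sub0r normrN => /(le_trans (ler_norm _)); apply: le_trans.
  have mst (u v : R) : 0 <= u <= 1 -> 0 <= v <= 1 ->
      measurable (G @^-1` (C u `\` C v)).
    by move=> u01 v01; exact: measurableD (mC u u01) (mC v v01).
  have lip (u v : R) : 0 <= u <= 1 -> 0 <= v <= 1 ->
      ((g u)%:E <= (g v)%:E + length_in G (C u `+` C v))%E.
    move=> u01 v01; rewrite -!gE//.
    have mY : measurable (G @^-1` (C u `+` C v)).
      exact: measurableU (mst u v u01 v01) (mst v u v01 u01).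
    apply: le_trans (length_inU (mC v v01) mY).
    apply: le_length_in; [exact: mC|exact: measurableU (mC v v01) mY|].
    by move=> x Cu; have [|] := pselect (C v x); [left|right; left].
  have gs : g s <= g t + fine (length_in G (C s `+` C t)).
    by rewrite -lee_fin EFinD (fineK fins); exact: lip.
  have gt : g t <= g s + fine (length_in G (C s `+` C t)).
    by rewrite -lee_fin EFinD (fineK fins) setYC; exact: lip.
  by rewrite -[X in `|X|]/(g t - g s) ler_norml; lra.
(* That [p 0] lies on the circle is read off [closed_arc] at time 0; the point is then a degenerate
   arc. *)
have g0 : g 0 = 0.
  have [|a [b [_ _ p0]]] := arcC 0; first by rewrite in_itv/= lexx ler01.
  have [u pu] : exists u, p 0 = G u by case: p0 => -[-> _]; [exists a|exists b].
  rewrite /g C0 pu -image_set1 -set_itv1 length_in_arc; last lra.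
  by rewrite arclengthxx.
have g1 : g 1 = L by rewrite /g C1 -/(circle_length G) circle_lengthE.
have [|t t01 gt] := @IVT R g 0 1 (2^-1 * L) ler01 cg.
  have L0 := arclength_ge0 G 0 1.
  by rewrite g0 g1 (min_idPl L0) (max_idPr L0); lra.
by exists t => //; rewrite gE// gt.
Unshelve. all: by end_near. Qed.

Lemma width_shortest_arcs :
  (forall x y : M, range G x -> range G y ->
    exists C, shortest_arc G x y C /\ riem_dist x y = length_in G C) ->
  width G = (2^-1 * L)%:E.
Proof.
move=> short; apply/eqP; rewrite eq_le width_le/=.
apply: le_ereal_inf_tmp => _ [p [q [C [pqC ->]]]].
have [t t01 half] := sweepout_half pqC.
have [_ _ arcC _ _] := pqC; have arct := arcC t t01.
apply: (@le_trans _ _ (riem_dist (p t) (q t))); last first.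
  by apply: ereal_sup_ubound; exists t.
have [||C' [[arc' _] ->]] := short (p t) (q t).
- by have [a [b [_ _ [[-> _]|[-> _]]]]] := arct; [exists a|exists b].
- by have [a [b [_ _ [[_ ->]|[_ ->]]]]] := arct; [exists b|exists a].
(* The shortest arc is as long as [C t] or complementary to it in length; both give half of [L]. *)
have [->|] := closed_arc_length_eq arct arc'; first by rewrite half.
by have [-> _] := closed_arc_length arc'; rewrite half -EFinD => -[]; rewrite lee_fin; lra.
Qed.

End Equivalence.

Theorem theoremD (R : realType) (n : nat) (M : riemannianManifold R n)
  (hM : riem_complete M) (G : embeddedCircle M) :
  width G = ((2^-1)%:E * circle_length G)%E
  <->
  (forall x y : M, range G x -> range G y ->
    exists C : set M, shortest_arc G x y C /\ riem_dist x y = length_in G C).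
Proof.
rewrite circle_lengthE -EFinM; split; last exact: width_shortest_arcs.
move=> wG _ _ [s _ <-] [t _ <-].
(* The parameter of [G t] in [s, s + 1). *)
pose b := t - (Num.floor (t - s))%:~R.
have -> : G t = G b by rewrite /b -rmorphN circleDz.
have sb : s <= b <= s + 1.
  have : (Num.floor (t - s))%:~R <= t - s by exact: ge_floor.
  have : t - s < (Num.floor (t - s))%:~R + 1 by rewrite -intrD1 floorD1_gt.
  by rewrite /b; lra.
have [short|long] := leP (arclength G s b) (arclength G b (s + 1)).
  exact: shortest_arc_width.
(* The shorter arc now runs from [b] to [s + 1], so the two points exchange roles; distance and arcs
   are symmetric in them. *)
have bs : b <= s + 1 <= b + 1 by lra.
have := shortest_arc_width bs _ wG; rewrite circle_periodic.
rewrite (_ : arclength G (s + 1) (b + 1) = arclength G s b); last first.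
  by have := @arclengthDz _ _ _ G s b 1; rewrite mulr1z; apply; lra.
move=> /(_ (ltW long)) [C [[arcC minC] dC]].
exists C; split; last by rewrite riem_dist_sym.
split; first exact: closed_arc_sym.
by move=> C' /closed_arc_sym; exact: minC.
Qed.
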